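(* Let $\theta$ be an ergodic measure preserving transformation (not assumed invertible) on a probability space $(\mathcal S, \Sigma, \mu)$, let $1 \le p < \infty$ be fixed, assume that the complex space $L_p(\mu)$ is infinite-dimensional, and let $Tf:=f \circ \theta$ be the induced isometry on $L_p(\mu)$. Then $T$ is not uniformly ergodic, and there exists $f \in \overline{(I-T)L_p(\mu)}$ such that the series $\sum_{n=1}^\infty \frac1n T^nf$ does not converge in $L_p$ norm.
   Context: A bounded operator $T$ is uniformly ergodic if $\frac1n\sum_{k=1}^nT^k$ converges in operator norm. *)

(* Defs.v *)
From HB Require Import structures.
From mathcomp Require Import all_boot all_order all_algebra.
From mathcomp Require Import all_classical all_reals all_analysis.
From mathcomp Require Import measurable_realfun generic_quotient ring_quotient complex.

Set Implicit Arguments.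
Unset Strict Implicit.
Unset Printing Implicit Defensive.

Import Order.TTheory GRing.Theory Num.Theory.
Import numFieldNormedType.Exports.
Import Normc.

Local Open Scope classical_set_scope.
Local Open Scope ring_scope.
Local Open Scope complex_scope.
Local Open Scope quotient_scope.

Section modulus.
Context {R : realType}.
Implicit Types z w : R[i].

Lemma normr_normc z : `|z| = (normc z)%:C.
Proof. by []. Qed.

Lemma normc_ge0 z : 0 <= normc z.
Proof. by case: z => a b /=; exact: sqrtr_ge0. Qed.

Lemma normcD_le z w : normc (z + w) <= normc z + normc w.
Proof. by have := ler_normD z w; rewrite !normr_normc -rmorphD/= lecR. Qed.

End modulus.

Section complex_Lp_functions.
Context d (S : measurableType d) (R : realType).
Variables (mu : {measure set S -> \bar R}) (p : R) (hp : 1 <= p).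
Implicit Types f g : S -> R[i].

(* [R[i]] carries no sigma-algebra in the libraries: measurability is that of
   the real and imaginary parts, i.e. Borel measurability *)
Definition measurable_cfun f : Prop :=
  measurable_fun [set: S] (fun x => complex.Re (f x)) /\
  measurable_fun [set: S] (fun x => complex.Im (f x)).

Definition cLnorm f : \bar R := 'N[mu]_(p%:E) [EFin \o (fun x => normc (f x))]%E.

(* the proof of [1 <= p] is a parameter only so that the submodule structure,
   which depends on it, can be inferred *)
Definition cLfun of 1 <= p : pred (S -> R[i]) :=
  fun f => `[< measurable_cfun f /\ (cLnorm f < +oo)%E >].

Let measurable_powRT (h : S -> R) : measurable_fun [set: S] h ->
  measurable_fun [set: S] (fun x => h x `^ p).
Proof. exact: (measurableT_comp (measurable_powR _)). Qed.

Lemma measurable_normc f : measurable_cfun f ->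
  measurable_fun [set: S] (fun x => normc (f x)).
Proof.
move=> [mr mi].
rewrite (_ : (fun x => _) =
  fun x => Num.sqrt (complex.Re (f x) ^+ 2 + complex.Im (f x) ^+ 2)); last first.
  by apply/funext => x; case: (f x).
apply: (@measurableT_comp _ _ _ _ _ _ (@Num.sqrt R)) => //.
  by apply: continuous_measurable_fun; exact: sqrt_continuous.
by apply: measurable_funD; exact: measurable_funX.
Qed.

Lemma measurable_cfunD f g : measurable_cfun f -> measurable_cfun g ->
  measurable_cfun (f + g).
Proof.
move=> [fr fi] [gr gi]; split.
- rewrite (_ : (fun x => _) = (fun x => complex.Re (f x)) \+ (fun x => complex.Re (g x))).
    exact: measurable_funD.
  by apply/funext => x; rewrite /= fctE; case: (f x); case: (g x).
- rewrite (_ : (fun x => _) = (fun x => complex.Im (f x)) \+ (fun x => complex.Im (g x))).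
    exact: measurable_funD.
  by apply/funext => x; rewrite /= fctE; case: (f x); case: (g x).
Qed.

Lemma measurable_cfunZ c f : measurable_cfun f -> measurable_cfun (c *: f).
Proof.
move=> [fr fi]; split.
- rewrite (_ : (fun x => _) =
    (fun x => complex.Re c * complex.Re (f x)) \- (fun x => complex.Im c * complex.Im (f x))).
    by apply: measurable_funB; exact: measurable_funM.
  by apply/funext => x; rewrite /= fctE; case: c; case: (f x).
- rewrite (_ : (fun x => _) =
    (fun x => complex.Re c * complex.Im (f x)) \+ (fun x => complex.Im c * complex.Re (f x))).
    by apply: measurable_funD; exact: measurable_funM.
  by apply/funext => x; rewrite /= fctE; case: c => a b; case: (f x).
Qed.

Lemma cLnorm_ge0 f : (0 <= cLnorm f)%E.
Proof. exact: Lnorm_ge0. Qed.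

Lemma cLnormE f :
  cLnorm f = ((\int[mu]_x (normc (f x) `^ p)%:E) `^ p^-1)%E.
Proof.
rewrite /cLnorm unlock /Lnorm; congr poweR; apply: eq_integral => x _ /=.
by rewrite ger0_norm ?normc_ge0.
Qed.

Let p_gt0 : 0 < p. Proof. exact: lt_le_trans hp. Qed.

Let measurable_normc_powR f : measurable_cfun f ->
  measurable_fun [set: S] (fun x => (normc (f x) `^ p)%:E).
Proof.
by move=> mf; apply/measurable_EFinP/measurable_powRT; exact: measurable_normc.
Qed.

Lemma cLnormD f g : measurable_cfun f -> measurable_cfun g ->
  (cLnorm (f + g)%R <= cLnorm f + cLnorm g)%E.
Proof.
move=> mf mg; have mf' := measurable_normc mf; have mg' := measurable_normc mg.
apply: le_trans (minkowski_EFin mu mf' mg' hp).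
rewrite cLnormE unlock /Lnorm; apply: gt0_ler_poweR.
- by rewrite invr_ge0 ltW.
- by rewrite in_itv/= leey integral_ge0// => x _; rewrite lee_fin powR_ge0.
- by rewrite in_itv/= leey integral_ge0// => x _; rewrite poweR_ge0.
apply: ge0_le_integral => //.
- by move=> x _; rewrite lee_fin powR_ge0.
- exact/measurable_normc_powR/measurable_cfunD.
- apply/measurable_EFinP/measurable_powRT/measurableT_comp => //.
  exact: measurable_funD.
- move=> x _; rewrite lee_fin; apply: ge0_ler_powR; rewrite ?nnegrE//.
  + exact: ltW.
  + exact: normc_ge0.
  + by rewrite ger0_norm ?addr_ge0 ?normc_ge0// normcD_le.
Qed.

Lemma cLnormZ c f : measurable_cfun f ->
  cLnorm (c *: f) = ((normc c)%:E * cLnorm f)%E.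
Proof.
move=> mf; rewrite !cLnormE.
under eq_integral => x _.
  rewrite fctE normcM powRM ?normc_ge0// EFinM.
  over.
rewrite ge0_integralZl//; last 3 first.
- exact: measurable_normc_powR.
- by move=> x _; rewrite lee_fin powR_ge0.
- by rewrite lee_fin powR_ge0.
rewrite poweRM ?integral_ge0// ?lee_fin ?powR_ge0//; last first.
  by move=> x _; rewrite lee_fin powR_ge0.
by rewrite poweR_EFin -powRrM mulfV ?gt_eqF// powRr1// normc_ge0.
Qed.

Lemma cLnorm_eq0 f : measurable_cfun f -> cLnorm f = 0%E -> f = 0 %[ae mu].
Proof.
move=> /measurable_normc mf /Lnorm_eq0_eq0 h.
have /h : measurable_fun [set: S] (EFin \o (fun x => normc (f x))).
  exact/measurable_EFinP.
rewrite lte_fin => /(_ p_gt0).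
by apply: filterS => x /(_ I)[] /eq0_normc.
Qed.

Lemma eq_cLnorm f g : measurable_cfun f -> measurable_cfun g ->
  f = g %[ae mu] -> cLnorm f = cLnorm g.
Proof.
move=> mf mg fg; rewrite !cLnormE; congr poweR.
apply: ae_eq_integral => //; [exact: measurable_normc_powR..|].
by apply: filterS fg => x /[apply] ->.
Qed.

Lemma cLfun_submod_closed : submod_closed (cLfun hp).
Proof.
split=> [|c f g /asboolP[mf lf] /asboolP[mg lg]]; apply/asboolP.
- split; first by split; exact: measurable_cst.
  rewrite cLnormE integral0_eq ?poweR0r ?invr_neq0 ?gt_eqF//.
  by move=> x _; rewrite [normc _]normc0 powR0 ?gt_eqF.
- have mcf := measurable_cfunZ c mf.
  split; first exact: measurable_cfunD.
  rewrite (le_lt_trans (cLnormD _ _))// lte_add_pinfty// cLnormZ//.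
  by rewrite lte_mul_pinfty// lee_fin normc_ge0.
Qed.

HB.instance Definition _ := GRing.isSubmodClosed.Build _ _ (cLfun hp)
  cLfun_submod_closed.

Record cLfunType := CLfun {
  cLfun_val :> S -> R[i];
  cLfunP : cLfun_val \in cLfun hp }.

HB.instance Definition _ := [isSub for cLfun_val].
HB.instance Definition _ := [Choice of cLfunType by <:].
HB.instance Definition _ := [SubChoice_isSubLmodule of cLfunType by <:].

Definition ae_null : pred cLfunType :=
  fun f : cLfunType => `[< (f : S -> R[i]) = 0 %[ae mu] >].

Lemma ae_null_submod_closed : submod_closed ae_null.
Proof.
split=> [|c f g /asboolP f0 /asboolP g0]; apply/asboolP.
  exact: aeW.
apply: filterS2 f0 g0 => x f0 g0 _.
have -> : (c *: f + g : cLfunType) x = c *: f x + g x by [].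
by rewrite f0// g0// scaler0 addr0.
Qed.

HB.instance Definition _ := GRing.isSubmodClosed.Build _ _ ae_null
  ae_null_submod_closed.

End complex_Lp_functions.
Arguments ae_null {d S R} mu {p} hp.

Section complex_Lp_space.
Context d (S : measurableType d) (R : realType).
Variables (mu : {measure set S -> \bar R}) (p : R) (hp : 1 <= p).
Local Notation cLfunType := (cLfunType mu hp).

(* the complex space L_p(mu): measurable functions with finite p-norm, modulo
   almost everywhere equality *)
Definition cLp : Type :=
  Quotient.quot (GRing.ZmodClosed.clone cLfunType (ae_null mu hp) _).

HB.instance Definition _ := GRing.Zmodule.on cLp.
HB.instance Definition _ := ZmodQuotient.on cLp.

Definition cLp_class (f : cLfunType) : cLp := \pi f.

Lemma cLp_classP (f g : cLfunType) :
  cLp_class f = cLp_class g <-> (f : S -> R[i]) = g %[ae mu].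
Proof.
have -> : (cLp_class f = cLp_class g) <-> (f - g \in ae_null mu hp).
  by rewrite Quotient.idealrBE; split=> [/eqP|/eqP].
split=> [/asboolP|] fg; [|apply/asboolP]; apply: filterS fg => x fg xT.
  by apply/eqP; rewrite -subr_eq0; apply/eqP; exact: fg.
by apply/eqP; rewrite [_ == _]subr_eq0; apply/eqP; exact: fg.
Qed.

Lemma cLp_ind (P : cLp -> Prop) :
  (forall f, P (cLp_class f)) -> forall u, P u.
Proof. by move=> h u; rewrite -[u]reprK; exact: h. Qed.

Lemma cLp_reprP (f : cLfunType) :
  (repr (cLp_class f) : S -> R[i]) = f %[ae mu].
Proof. by apply/cLp_classP; rewrite /cLp_class reprK. Qed.

Definition cLp_scale (c : R[i]) (u : cLp) : cLp := cLp_class (c *: repr u).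

Lemma cLp_classD (f g : cLfunType) :
  cLp_class (f + g) = cLp_class f + cLp_class g.
Proof. by rewrite /cLp_class raddfD. Qed.

Lemma cLp_scale_class c f : cLp_scale c (cLp_class f) = cLp_class (c *: f).
Proof.
apply/cLp_classP; apply: filterS (cLp_reprP f) => x + xT => /(_ xT) fx.
by have -> : (c *: repr (cLp_class f) : cLfunType) x =
  c *: repr (cLp_class f) x by []; rewrite fx.
Qed.

Fact cLp_scaleA a b u : cLp_scale a (cLp_scale b u) = cLp_scale (a * b) u.
Proof. by elim/cLp_ind: u => f; rewrite !cLp_scale_class scalerA. Qed.

Fact cLp_scale1 : left_id 1 cLp_scale.
Proof. by elim/cLp_ind => f; rewrite cLp_scale_class scale1r. Qed.

Fact cLp_scaleDr : right_distributive cLp_scale +%R.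
Proof.
move=> c; elim/cLp_ind => f; elim/cLp_ind => g.
by rewrite -cLp_classD !cLp_scale_class scalerDr cLp_classD.
Qed.

Fact cLp_scaleDl u : {morph cLp_scale^~ u : a b / a + b}.
Proof.
by move=> a b; elim/cLp_ind: u => f; rewrite !cLp_scale_class scalerDl cLp_classD.
Qed.

HB.instance Definition _ := GRing.Zmodule_isLmodule.Build R[i] cLp
  cLp_scaleA cLp_scale1 cLp_scaleDr cLp_scaleDl.

Lemma cLp_classZ c (f : cLfunType) : cLp_class (c *: f) = c *: cLp_class f.
Proof. by rewrite -cLp_scale_class. Qed.

Definition cLp_norm (u : cLp) : R[i] := (fine (cLnorm mu p (repr u)))%:C.

Lemma cLfun_measurable (f : cLfunType) : measurable_cfun f.
Proof. by have /asboolP[] := cLfunP f. Qed.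

Lemma cLfun_fin_num (f : cLfunType) : cLnorm mu p f \is a fin_num.
Proof. by have /asboolP[_ ?] := cLfunP f; rewrite ge0_fin_numE ?cLnorm_ge0. Qed.

Lemma cLp_norm_class (f : cLfunType) :
  cLp_norm (cLp_class f) = (fine (cLnorm mu p f))%:C.
Proof.
congr ((fine _)%:C); apply: eq_cLnorm; try exact: cLfun_measurable.
exact: cLp_reprP.
Qed.

Fact cLp_normD u v : cLp_norm (u + v) <= cLp_norm u + cLp_norm v.
Proof.
elim/cLp_ind: u => f; elim/cLp_ind: v => g; rewrite -cLp_classD !cLp_norm_class.
rewrite -rmorphD/= lecR -fineD ?cLfun_fin_num// fine_le ?fin_numD ?cLfun_fin_num//.
  exact: (cLfun_fin_num (f + g)).
by apply: cLnormD => //; exact: cLfun_measurable.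
Qed.

Fact cLp_normZ c u : cLp_norm (c *: u) = `|c| * cLp_norm u.
Proof.
elim/cLp_ind: u => f; rewrite -cLp_classZ !cLp_norm_class normr_normc -rmorphM/=.
congr (_%:C); rewrite (@cLnormZ _ _ _ mu p hp c f); last exact: cLfun_measurable.
by rewrite fineM// cLfun_fin_num.
Qed.

Fact cLp_norm0_eq0 u : cLp_norm u = 0 -> u = 0.
Proof.
elim/cLp_ind: u => f; rewrite cLp_norm_class => -[f0].
rewrite -[RHS](_ : cLp_class 0 = 0); last by rewrite /cLp_class raddf0.
apply/cLp_classP; apply: (cLnorm_eq0 hp) (cLfun_measurable f) _.
by rewrite -[LHS]fineK ?cLfun_fin_num// f0.
Qed.

HB.instance Definition _ := Lmodule_isNormed.Build R[i] cLp
  cLp_normD cLp_normZ cLp_norm0_eq0.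

End complex_Lp_space.

Section measure_preserving.
Context d (S : measurableType d) (R : realType).
Variable mu : {measure set S -> \bar R}.

Definition measure_preserving (theta : S -> S) : Prop :=
  measurable_fun [set: S] theta /\
  forall A, measurable A -> mu (theta @^-1` A) = mu A.

Definition ergodic (theta : S -> S) : Prop :=
  forall A, measurable A -> theta @^-1` A = A -> mu A = 0%E \/ mu (~` A) = 0%E.

Variables (theta : S -> S) (mptheta : measure_preserving theta).
Variables (p : R) (hp : 1 <= p).

Lemma ae_eq_comp_mp U (f g : S -> U) :
  f = g %[ae mu] -> f \o theta = g \o theta %[ae mu].
Proof.
have [mtheta mutheta] := mptheta.
move=> [N [mN N0 fgN]]; exists (theta @^-1` N); split.
- by rewrite -[X in measurable X]setTI; exact: mtheta.
- by rewrite mutheta.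
- by move=> x fgx; apply: fgN.
Qed.

Lemma cLnorm_comp_mp (f : S -> R[i]) : measurable_cfun f ->
  cLnorm mu p (f \o theta) = cLnorm mu p f.
Proof.
have [mtheta mutheta] := mptheta.
move=> mf; rewrite !cLnormE; congr poweR.
rewrite [RHS](eq_measure_integral (pushforward mu theta)).
  rewrite [RHS]ge0_integral_pushforward//.
  - apply: measurableT_comp => //; apply: (measurableT_comp (measurable_powR _)).
    exact: measurable_normc.
  - by move=> x _; rewrite lee_fin powR_ge0.
by move=> A mA _; apply/esym; exact: mutheta.
Qed.

Lemma cLfun_comp_mp (f : cLfunType mu hp) : (f \o theta) \in cLfun mu hp.
Proof.
have [mfr mfi] := cLfun_measurable f; have [mtheta _] := mptheta.
apply/asboolP; split.
  by split; [exact: (measurableT_comp mfr)|exact: (measurableT_comp mfi)].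
by rewrite cLnorm_comp_mp//; have /asboolP[] := cLfunP f.
Qed.

(* f |-> f \o theta on classes; independent of the representative by
   [koopman_class] *)
Definition koopman (u : cLp mu hp) : cLp mu hp :=
  cLp_class (CLfun (cLfun_comp_mp (repr u))).

Lemma koopman_class (f : cLfunType mu hp) :
  koopman (cLp_class f) = cLp_class (CLfun (cLfun_comp_mp f)).
Proof. by apply/cLp_classP; exact: ae_eq_comp_mp (cLp_reprP f). Qed.

Fact koopman_is_linear : linear koopman.
Proof.
move=> c; elim/cLp_ind => f; elim/cLp_ind => g.
rewrite -cLp_classZ -cLp_classD !koopman_class -cLp_classZ -cLp_classD.
by congr cLp_class; exact/val_inj.
Qed.

HB.instance Definition _ := GRing.isLinear.Build _ _ _ _ koopman
  koopman_is_linear.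

Lemma norm_koopman (u : cLp mu hp) : `|koopman u| = `|u|.
Proof.
elim/cLp_ind: u => f; rewrite koopman_class.
rewrite [LHS]cLp_norm_class [RHS]cLp_norm_class.
by rewrite cLnorm_comp_mp//; exact: cLfun_measurable.
Qed.

Lemma continuous_koopman : continuous koopman.
Proof.
apply: bounded_linear_continuous; apply/linear_boundedP; exists 1.
by split=> // r r1 u; rewrite norm_koopman ler_peMl// ltW.
Qed.

End measure_preserving.
Arguments koopman {d S R mu theta} mptheta {p} hp u.

Definition finite_dimensional (K : fieldType) (V : lmodType K) : Prop :=
  exists (n : nat) (b : 'I_n -> V), forall v : V,
    exists c : 'I_n -> K, v = \sum_(i < n) c i *: b i.

Section uniform_ergodicity.
Context {R : realType} {V : normedModType R[i]}.

(* norms over [R[i]] take values in [R[i]]; [complex.Re] brings them to [R] *)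
Definition opnorm (A : V -> V) : \bar R :=
  ereal_sup [set (complex.Re `|A x|)%:E | x in [set x : V | `|x| <= 1]].

Definition cesaro (T : V -> V) (n : nat) : V -> V :=
  fun x => n%:R^-1 *: \sum_(1 <= k < n.+1) iter k T x.

Definition uniformly_ergodic (T : {linear V -> V}) : Prop :=
  exists2 E : {linear V -> V}, continuous E &
    opnorm (fun x => cesaro T n x - E x) @[n --> \oo] --> 0%E.

End uniform_ergodicity.

(* Main.v *)
Require Import Defs.
From mathcomp Require Import all_boot all_order all_algebra.
From mathcomp Require Import all_classical all_reals all_analysis.
From mathcomp Require Import complex.
From mathcomp Require Import measurable_realfun ring lra.

(** The space being infinite-dimensional, there are sets B of arbitrarily small
    positive measure: otherwise a finest finite partition into sets of positive
    measure exists, and the indicators of its cells span the space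
    ([small_measurable_sets]). By ergodicity almost every orbit enters B, so the
    first hitting time r of B is finite almost everywhere
    ([ergodic_ae_hits]). For |l| = 1 the function h = l^-r has modulus 1 and
    h o theta = l h outside B. As B shrinks, every point l of the unit circle is thus
    an approximate eigenvalue of T ([koopman_approximate_eigenvector]).

    Letting l tend to 1, the coboundaries h - T h, once normalized, become almost
    invariant: there are unit vectors u in the range of I - T with T u - u as small
    as desired ([almost_invariant_of_approximate_eigenvectors]). The rest is operator
    theory for a contraction T. A limit of the Cesaro means vanishes on the range of
    I - T, while each single mean almost fixes some such u, so the convergence is not
    uniform ([not_uniformly_ergodic]). Likewise the partial sum of order N of the
    series of T^n / n maps some such u to almost H_N u, with H_N the harmonic
    number, so these sums are not uniformly bounded on the range of I - T. A gliding
    hump then builds f in its closure for which the series has unbounded partial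
    sums ([divergent_hilbert_series]). The hump only needs the convergence in Lp of
    series with geometrically decreasing norms ([cLp_geometric_series_cvg]). *)

Import Order.TTheory GRing.Theory Num.Theory.
Import numFieldNormedType.Exports.
Import Normc.

Set Implicit Arguments.
Unset Strict Implicit.
Unset Printing Implicit Defensive.

Local Open Scope classical_set_scope.
Local Open Scope ring_scope.
Local Open Scope complex_scope.

(** * Real-valued norms *)

Section real_norm.
Context {R : realType} {V : normedModType R[i]}.
Implicit Types (x y : V) (c : R[i]).

(** The norm of a complex normed module takes its values in [R[i]], which is only
    partially ordered; its real part allows linear arithmetic over [R]. *)
Definition rnorm x : R := complex.Re `|x|.

Lemma rnormE x : `|x| = (rnorm x)%:C.
Proof. by rewrite RRe_real// normr_real. Qed.

Lemma rnorm_le x (r : R) : (rnorm x <= r) = (`|x| <= r%:C).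
Proof. by rewrite rnormE lecR. Qed.

Lemma rnorm_ge0 x : 0 <= rnorm x.
Proof. by rewrite -lecR -rnormE normr_ge0. Qed.

Lemma rnorm0 : rnorm 0 = 0.
Proof. by rewrite /rnorm normr0. Qed.

Lemma rnormD x y : rnorm (x + y) <= rnorm x + rnorm y.
Proof. by rewrite rnorm_le rmorphD/= -!rnormE ler_normD. Qed.

Lemma rnormN x : rnorm (- x) = rnorm x.
Proof. by rewrite /rnorm normrN. Qed.

Lemma rnorm_dist x y : rnorm (x - y) = rnorm (y - x).
Proof. by rewrite -opprB rnormN. Qed.

Lemma rnorm_sub_ge x y : rnorm x - rnorm y <= rnorm (x - y).
Proof. by have := rnormD (x - y) y; rewrite subrK; lra. Qed.

Lemma rnorm_triangle z x y : rnorm (x - y) <= rnorm (x - z) + rnorm (z - y).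
Proof. by apply: le_trans (rnormD _ _); rewrite addrA subrK. Qed.

Lemma rnormZ c x : rnorm (c *: x) = normc c * rnorm x.
Proof.
by apply: (@complexI R); rewrite -rnormE normrZ normr_normc rnormE -rmorphM.
Qed.

Lemma normcR (r : R) : normc r%:C = `|r|.
Proof. by rewrite /normc/= expr0n/= addr0 sqrtr_sqr. Qed.

Lemma rnorm_sum (I : Type) (s : seq I) (P : pred I) (F : I -> V) :
  rnorm (\sum_(i <- s | P i) F i) <= \sum_(i <- s | P i) rnorm (F i).
Proof.
elim/big_ind2 : _ => [|x a y b xa yb|//]; first by rewrite rnorm0.
by apply: le_trans (rnormD _ _) _; exact: lerD.
Qed.

Lemma rnorm_cvgP (u : V^nat) (l : V) :
  (forall e, 0 < e -> \forall n \near \oo, rnorm (l - u n) <= e) <->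
  u @ \oo --> l.
Proof.
split=> [h|h e e0].
  apply/cvgrPdist_le => e e0.
  have eR : e = (complex.Re e)%:C by rewrite RRe_real// gtr0_real.
  rewrite eR; move: e0; rewrite eR ltcR => /h; apply: filterS => n.
  by rewrite rnorm_le.
move/cvgrPdist_le : h => /(_ e%:C).
by rewrite ltcR => /(_ e0); apply: filterS => n; rewrite rnorm_le.
Qed.

Lemma rnorm_geometric_tail (y : V^nat) :
  (forall n, rnorm (y n) <= 4^-1 ^+ n) -> forall n k,
  rnorm (series y (n + k)%N - series y n) <= 4^-1 ^+ n * (4 / 3 * (1 - 4^-1 ^+ k)).
Proof.
move=> yle n; elim=> [|k IH]; first by rewrite addn0 subrr rnorm0 subrr !mulr0.
rewrite addnS; apply: (le_trans (rnorm_triangle (series y (n + k)%N) _ _)).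
rewrite seriesSB; have := yle (n + k)%N.
rewrite exprD exprS => h; move: IH.
set a := 4^-1 ^+ n in h *; set b := 4^-1 ^+ k in h *.
by nra.
Qed.

End real_norm.

(** * Contractions with almost invariant coboundaries *)

Section weighted_sums.
Context {R : realType} {V : normedModType R[i]} (T : {linear V -> V}).
Hypothesis contr_T : forall x, rnorm (T x) <= rnorm x.
Implicit Types (w : nat -> R) (x u g : V) (n : nat).

(** Covers both the Cesaro means (weights 1/n) and the partial sums of the
    one-sided ergodic Hilbert transform (weights 1/k). *)
Definition weighted_sum w n x := \sum_(1 <= k < n.+1) (w k)%:C *: iter k T x.

Lemma iterTB k x y : iter k T (x - y) = iter k T x - iter k T y.
Proof. by elim: k => //= k ->; rewrite linearB. Qed.

Lemma rnorm_iter k x : rnorm (iter k T x) <= rnorm x.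
Proof. by elim: k => //= k; apply: le_trans. Qed.

Lemma rnorm_iter_sub k u : rnorm (iter k T u - u) <= k%:R * rnorm (T u - u).
Proof.
elim: k => [|k IH]; first by rewrite /= subrr rnorm0 mul0r.
rewrite iterS; apply: (le_trans (rnorm_triangle (T u) _ _)).
rewrite -linearB -addn1 natrD mulrDl mul1r lerD2r.
exact: le_trans (contr_T _) IH.
Qed.

Lemma weighted_sumB w n x y :
  weighted_sum w n (x - y) = weighted_sum w n x - weighted_sum w n y.
Proof.
rewrite /weighted_sum -sumrB; apply: eq_bigr => k _.
by rewrite iterTB scalerBr.
Qed.

Lemma rnorm_weighted_sum w n x : (forall k, 0 <= w k) ->
  rnorm (weighted_sum w n x) <= (\sum_(1 <= k < n.+1) w k) * rnorm x.
Proof.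
move=> w0; apply: (le_trans (rnorm_sum _ _ _)); rewrite mulr_suml.
apply: ler_sum => k _; rewrite rnormZ normcR ger0_norm//.
by rewrite ler_wpM2l// rnorm_iter.
Qed.

(** A weighted sum moves an almost invariant vector to almost a multiple of
    itself: T^k u stays within k |T u - u| of u. *)
Lemma weighted_sum_near w n u : (forall k, 0 <= w k) ->
  rnorm (weighted_sum w n u - (\sum_(1 <= k < n.+1) w k)%:C *: u) <=
  (\sum_(1 <= k < n.+1) w k * k%:R) * rnorm (T u - u).
Proof.
move=> w0; rewrite raddf_sum/= scaler_suml -sumrB.
apply: (le_trans (rnorm_sum _ _ _)); rewrite mulr_suml.
apply: ler_sum => k _; rewrite -scalerBr rnormZ normcR ger0_norm// -mulrA.
by rewrite ler_wpM2l// rnorm_iter_sub.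
Qed.

(** Says that I - T is not bounded below on its own range. *)
Definition almost_invariant_coboundaries := forall e : R, 0 < e ->
  exists g, rnorm (g - T g) = 1 /\ rnorm (T (g - T g) - (g - T g)) <= e.

(** The sum of T^k (g - T g) telescopes. *)
Lemma rnorm_cesaro_coboundary n g : rnorm (Defs.cesaro T n (g - T g)) <=
  n%:R^-1 * (2 * rnorm g).
Proof.
rewrite /Defs.cesaro rnormZ.
have -> : n%:R^-1 = (n%:R^-1)%:C :> R[i] by rewrite fmorphV rmorph_nat.
rewrite normcR ger0_norm ?invr_ge0//; apply: ler_wpM2l; first by rewrite invr_ge0.
under eq_bigr do rewrite iterTB -iterSr -opprB.
rewrite sumrN telescope_sumr//= opprB; apply: (le_trans (rnormD _ _)).
rewrite rnormN mulr2n mulrDl mul1r; apply: lerD => //.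
by rewrite -iterS rnorm_iter.
Qed.

Lemma cesaroE n x : Defs.cesaro T n x = weighted_sum (fun=> n%:R^-1) n x.
Proof.
rewrite /Defs.cesaro /weighted_sum scaler_sumr; apply: eq_bigr => k _.
by rewrite fmorphV rmorph_nat.
Qed.

(** On a coboundary the Cesaro means tend to 0, so a uniform limit E of the
    Cesaro means vanishes there. Uniformity gives one n for which the n-th mean is
    within 1/8 of E on the whole unit ball; but that mean almost fixes a unit
    coboundary that is sufficiently invariant. *)
Lemma not_uniformly_ergodic :
  almost_invariant_coboundaries -> ~ uniformly_ergodic T.
Proof.
move=> ai [E _ AE].
have [n0 small] : exists n0, forall n, (n0 <= n)%N -> forall x, rnorm x <= 1 ->
    rnorm (Defs.cesaro T n x - E x) <= 8^-1.
  have /fine_cvgP[fin /cvgrPdist_le/(_ 8^-1)] := AE.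
  rewrite invr_gt0 => /(_ ltac:(by [])) le8.
  have [n0 _ h] := filterI fin le8; exists n0 => n /h[/= fn].
  rewrite sub0r normrN => le8n x x1; rewrite -lee_fin.
  apply: (@le_trans _ _ (opnorm (fun x => Defs.cesaro T n x - E x))).
    apply: ereal_sup_ubound; exists x => //=.
    by move: x1; rewrite rnorm_le.
  by rewrite -(fineK fn) lee_fin (le_trans (ler_norm _)).
pose n := n0.+1.
(* the n-th mean displaces u by at most n |T u - u|, which is kept below 1/4 *)
have [g [u1 Tu]] := ai (4^-1 / n%:R) ltac:(by rewrite divr_gt0// ltr0n).
set u := g - T g in u1 Tu *.
have Eu : rnorm (E u) <= 4^-1 + 4^-1.
  (* E u is compared with a later mean, whose order depends on g and not only on n *)
  pose m := (n + Num.bound (8 * rnorm g))%N.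
  have m0 : 0 < m%:R :> R by rewrite ltr0n.
  have := rnorm_cesaro_coboundary m g; rewrite -/u.
  have : m%:R^-1 * (2 * rnorm g) <= 4^-1.
    rewrite mulrC ler_pdivrMr//.
    have : 8 * rnorm g <= m%:R.
      apply: (@le_trans _ _ (Num.bound (8 * rnorm g))%:R); last first.
        by rewrite ler_nat leq_addl.
      by apply/ltW/archi_boundP; rewrite mulr_ge0// rnorm_ge0.
    by lra.
  have := small m _ u _; rewrite u1.
  have := rnorm_sub_ge (E u) (Defs.cesaro T m u); rewrite rnorm_dist.
  move=> h1 /(_ _ (lexx _)) h2.
  have {}h2 := h2 (leq_trans (leqnSn _) (leq_addr _ _)).
  by lra.
have := small n (leqnSn _) u; rewrite u1 => /(_ (lexx _)) Anu.
have : rnorm (Defs.cesaro T n u - u) <= 4^-1.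
  have n1 : 0 <= n%:R^-1 :> R by rewrite invr_ge0.
  have := weighted_sum_near (w := fun=> n%:R^-1) n u (fun=> n1).
  have nn : n%:R * n%:R^-1 = 1 :> R by rewrite mulfV ?pnatr_eq0.
  have -> : \sum_(1 <= k < n.+1) n%:R^-1 = 1 :> R.
    by rewrite sumr_const_nat subn1/= -[LHS]mulr_natl.
  rewrite scale1r -cesaroE.
  move=> /le_trans; apply; apply: (@le_trans _ _ (n%:R * (4^-1 / n%:R))).
    apply: ler_pM => //; [|exact: rnorm_ge0|].
      by apply: sumr_ge0 => k _; rewrite mulr_ge0.
    rewrite -[leRHS](_ : \sum_(1 <= k < n.+1) 1 = _); last first.
      by rewrite sumr_const_nat subn1.
    apply: ler_sum_nat => k /andP[_ kn].
    by rewrite mulrC ler_pdivrMr ?ltr0n// mul1r ler_nat -ltnS.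
  by rewrite mulrCA nn mulr1.
have := rnorm_triangle (Defs.cesaro T n u) u (E u).
have := rnorm_sub_ge u (E u).
by rewrite (rnorm_dist u (Defs.cesaro T n u)) u1; lra.
Qed.

Lemma weighted_sumZ w n c x :
  weighted_sum w n (c *: x) = c *: weighted_sum w n x.
Proof.
rewrite /weighted_sum scaler_sumr; apply: eq_bigr => k _.
rewrite scalerA mulrC -scalerA; congr (_ *: _).
by elim: k => //= k ->; rewrite linearZ.
Qed.

Definition harmonic_sum n : R := \sum_(1 <= k < n.+1) k%:R^-1.

Lemma harmonic_sum_unbounded (M : R) : exists n, M <= harmonic_sum n.
Proof.
apply: contrapT => /forallNP noM; apply: (@dvg_harmonic R).
apply: nondecreasing_is_cvgn.
  by apply: nondecreasing_series => k _ _; rewrite /= invr_ge0.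
exists M => _ [n _ <-]; have /negP := noM n; rewrite -ltNge => /ltW.
by rewrite /harmonic_sum big_add1.
Qed.

(** The partial sums of order n have norm at most the n-th harmonic number; an
    almost invariant vector nearly attains it. *)
Lemma hilbert_sum_almost_invariant n u : rnorm u = 1 ->
  n%:R * rnorm (T u - u) <= 8^-1 ->
  harmonic_sum n - 8^-1 <= rnorm (weighted_sum (fun k => k%:R^-1) n u).
Proof.
move=> u1 nTu; have w0 k : 0 <= k%:R^-1 :> R by rewrite invr_ge0.
have := weighted_sum_near (w := fun k => k%:R^-1) n u w0.
have -> : \sum_(1 <= k < n.+1) k%:R^-1 * k%:R = n%:R :> R.
  rewrite (eq_big_nat _ _ (F2 := fun=> 1)); first by rewrite sumr_const_nat subn1.
  by move=> k /andP[k1 _]; rewrite mulVf// pnatr_eq0 -lt0n.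
rewrite rnorm_dist => h; have := rnorm_sub_ge ((harmonic_sum n)%:C *: u)
  (weighted_sum (fun k => k%:R^-1) n u).
rewrite [rnorm (_ *: u)]rnormZ normcR u1 mulr1.
have := ler_norm (harmonic_sum n); move: h; rewrite -/(harmonic_sum n); lra.
Qed.

(** Since 2 v = (z + v) - (z - v), one of the two signs does not decrease the
    image of v. *)
Lemma weighted_sum_sign_choice w n z v :
  rnorm (weighted_sum w n v) <= rnorm (weighted_sum w n (z + v)) \/
  rnorm (weighted_sum w n v) <= rnorm (weighted_sum w n (z - v)).
Proof.
have [le|lt] := leP (rnorm (weighted_sum w n v)) (rnorm (weighted_sum w n (z + v))).
  by left.
right; have := rnormD (weighted_sum w n (z + v)) (- weighted_sum w n (z - v)).
rewrite rnormN -weighted_sumB.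
have -> : z + v - (z - v) = 2%:R *: v.
  by rewrite scaler_nat mulr2n opprB addrC addrA subrK.
rewrite weighted_sumZ rnormZ (_ : normc 2%:R = 2); first by move: lt; lra.
have -> : 2%:R = (2%:R)%:C :> R[i] by rewrite rmorph_nat.
by rewrite normcR ger0_norm.
Qed.

(** Sokal's gliding hump, a proof of the uniform boundedness principle without
    Baire's theorem. Starting from 0, the n-th step adds plus or minus 4^-n u_n,
    where u_n is a unit coboundary on which the Hilbert sum of order N_n nearly
    attains its norm H, the sign being chosen so that the image of the new point
    under that sum has norm about 4^-n H. All later steps together move the point by
    at most half of 4^-n, hence the image by at most half of 4^-n H. With H of size
    n 4^n, the Hilbert sums of the limit point are unbounded. *)
Lemma divergent_hilbert_series :
  (forall y : V^nat, (forall n, rnorm (y n) <= 4^-1 ^+ n) -> cvgn (series y)) ->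
  almost_invariant_coboundaries ->
  exists f, closure (range (fun g => g - T g)) f /\
    ~ cvgn (fun N => \sum_(1 <= n < N.+1) n%:R^-1 *: iter n T f).
Proof.
move=> complV ai.
pose S := weighted_sum (fun k => k%:R^-1).
have w0 k : 0 <= k%:R^-1 :> R by rewrite invr_ge0.
have /choice[N HN] n : exists N, 1 + 4 ^+ n * (3 * n%:R) <= harmonic_sum N.
  exact: harmonic_sum_unbounded.
have /choice[g gP] n : exists g, rnorm (g - T g) = 1 /\
    rnorm (T (g - T g) - (g - T g)) <= 8^-1 / (N n).+1%:R.
  by apply: ai; rewrite divr_gt0.
pose u n := g n - T (g n).
have q0 n : 0 <= 4^-1 ^+ n :> R by rewrite exprn_ge0.
have Su n : 4^-1 ^+ n * (harmonic_sum (N n) - 8^-1) <=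
    rnorm (S (N n) ((4^-1 ^+ n)%:C *: u n)).
  rewrite /S weighted_sumZ rnormZ normcR ger0_norm//; apply: ler_wpM2l => //.
  have [u1 Tu] := gP n; apply: hilbert_sum_almost_invariant => //.
  apply: (le_trans (ler_wpM2l _ Tu)) => //.
  by rewrite mulrCA ler_piMr// ler_pdivrMr// mul1r ler_nat.
have stepP (nz : nat * V) : exists v, [/\ rnorm v = 4^-1 ^+ nz.1,
    exists h, v = h - T h &
    4^-1 ^+ nz.1 * (harmonic_sum (N nz.1) - 8^-1) <= rnorm (S (N nz.1) (nz.2 + v))].
  case: nz => n z /=; pose v := (4^-1 ^+ n)%:C *: u n.
  have v1 : rnorm v = 4^-1 ^+ n.
    by rewrite rnormZ normcR ger0_norm// (gP n).1 mulr1.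
  have vT : v = (4^-1 ^+ n)%:C *: g n - T ((4^-1 ^+ n)%:C *: g n).
    by rewrite linearZ -scalerBr.
  have [le|le] := weighted_sum_sign_choice (fun k => k%:R^-1) (N n) z v.
    exists v; split => //; first by exists ((4^-1 ^+ n)%:C *: g n).
    exact: le_trans (Su n) le.
  exists (- v); split; first by rewrite rnormN.
    by exists (- ((4^-1 ^+ n)%:C *: g n)); rewrite linearN opprK vT opprB addrC.
  exact: le_trans (Su n) le.
have /choice[step {}stepP] := stepP.
pose x : V^nat := fun n => nat_rect (fun=> V) 0 (fun n z => z + step (n, z)) n.
have xS n : x n.+1 = x n + step (n, x n) by [].
pose y n := step (n, x n).
have xE n : x n = series y n.
  elim: n => [|n IH]; first by rewrite /series/= big_geq.
  by rewrite xS {1}IH /series/= big_nat_recr.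
have yle n : rnorm (y n) <= 4^-1 ^+ n by have [->] := stepP (n, x n).
pose f := limn (series y); have yf : series y @ \oo --> f := complV y yle.
exists f; split.
  have xT n : range (fun g => g - T g) (series y n).
    elim: n => [|n [h _ hE]].
      by exists 0 => //; rewrite linear0 subr0 /series/= big_geq.
    have [_ [k kE] _] := stepP (n, x n); exists (h + k) => //.
    by rewrite -xE xS kE xE -hE linearD opprD addrACA.
  move=> B /yf[n0 _ n0B]; exists (series y n0); split; first exact: xT.
  by apply: n0B => /=.
(* the steps after the n-th have total length at most 4^-n / 3 *)
have fx n : rnorm (f - x n.+1) <= 4^-1 ^+ n / 2.
  have q6 : 0 < 4^-1 ^+ n / 6 :> R by rewrite divr_gt0// exprn_gt0// invr_gt0.
  have [m0 _ /(_ (n.+1 + m0)%N) /=] := (rnorm_cvgP _ _).2 yf _ q6.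
  rewrite leq_addl => /(_ isT); rewrite -xE => fm.
  apply: (le_trans (rnorm_triangle (x (n.+1 + m0)%N) _ _)).
  have := rnorm_geometric_tail yle n.+1 m0; rewrite -!xE exprS.
  have : 0 <= 4^-1 ^+ m0 :> R by [].
  have := q0 n; move: fm.
  set a := 4^-1 ^+ n; set b := 4^-1 ^+ m0; nra.
move=> /cvg_seq_bounded[M [Mreal /(_ (M + 1))]].
rewrite ltrDl => /(_ ltr01 _) aM.
have {aM} SM k : rnorm (S k f) <= complex.Re (M + 1).
  rewrite rnorm_le RRe_real ?realD//.
  have -> : S k f = \sum_(1 <= n < k.+1) n%:R^-1 *: iter n T f.
    by apply: eq_bigr => j _; rewrite fmorphV rmorph_nat.
  exact: aM.
have M0 : 0 <= complex.Re (M + 1) by apply: le_trans (SM 0%N); exact: rnorm_ge0.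
pose n := Num.bound (complex.Re (M + 1)).
have nM : complex.Re (M + 1) < n%:R by exact: archi_boundP.
have := SM (N n); apply/negP; rewrite -ltNge; apply: (lt_le_trans nM).
have [_ _] := stepP (n, x n); rewrite /= -xS => Sx.
have := rnorm_sub_ge (S (N n) (x n.+1)) (S (N n) f).
rewrite rnorm_dist -weighted_sumB.
have := rnorm_weighted_sum (N n) (f - x n.+1) w0; rewrite -/(harmonic_sum _).
have := fx n; have := q0 n; have := HN n.
have : 4^-1 ^+ n * 4 ^+ n = 1 :> R by rewrite -exprMn mulVf// expr1n.
move: Sx; set a := 4^-1 ^+ n; set b := 4 ^+ n; set H := harmonic_sum _.
move=> h1 h2 h3 h4 h5 h6 h7.
have aH : a + 3 * n%:R <= a * H.
  by apply: le_trans (ler_wpM2l h4 h3); rewrite mulrDr mulr1 [a * (b * _)]mulrA h2 mul1r.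
have : H * rnorm (f - x n.+1) <= H * (a / 2) by apply: ler_wpM2l => //; nra.
have : 0 <= n%:R :> R by [].
nra.
Qed.

End weighted_sums.

(** * From approximate eigenvectors to almost invariant coboundaries *)

Section approximate_eigenvectors.
Context {R : realType}.

Lemma unit_circle_dist (e : R) : 0 <= e <= 1 ->
  exists l : R[i], normc l = 1 /\ normc (1 - l) = e.
Proof.
(* on the unit circle, |1 - l|^2 = 2 (1 - Re l) *)
move=> /andP[e0 e1]; pose a := 1 - e ^+ 2 / 2.
have a0 : 0 <= 1 - a ^+ 2.
  have -> : 1 - a ^+ 2 = e ^+ 2 * (1 - e / 2 * (e / 2)) by rewrite /a; field.
  by rewrite mulr_ge0 ?sqr_ge0//; nra.
exists (Complex a (Num.sqrt (1 - a ^+ 2))); split.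
  by rewrite /normc sqr_sqrtr// addrC subrK sqrtr1.
rewrite (_ : 1 - _ = Complex (1 - a) (- Num.sqrt (1 - a ^+ 2))); last first.
  by apply/eqP; rewrite eq_complex/= sub0r !eqxx.
rewrite /normc sqrrN sqr_sqrtr// -[RHS]ger0_norm// -sqrtr_sqr; congr Num.sqrt.
by rewrite /a; field.
Qed.

(** If T h is close to l h with l a point of the unit circle close to 1, then
    u = h - T h is close to (1 - l) h, so that T u - u is about (l - 1) u. The error
    in T h = l h is taken of size |1 - l|^2 / 4, because u itself only has norm about
    |1 - l|. *)
Lemma almost_invariant_of_approximate_eigenvectors (V : normedModType R[i])
    (T : {linear V -> V}) :
  (forall x, rnorm (T x) <= rnorm x) ->
  (forall (l : R[i]) (e : R), normc l = 1 -> 0 < e ->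
    exists h, rnorm h = 1 /\ rnorm (T h - l *: h) <= e) ->
  almost_invariant_coboundaries T.
Proof.
move=> contrT eig e e0.
pose dl : R := Num.min 1 (e / 2).
have dl0 : 0 < dl by rewrite lt_min ltr01 divr_gt0.
have dl1 : dl <= 1 by rewrite ge_min lexx.
have dle : dl <= e / 2 by rewrite ge_min lexx orbT.
have [l [l1 l1d]] := unit_circle_dist (introT andP (conj (ltW dl0) dl1)).
have [|h [h1 Th]] := eig l (dl ^+ 2 / 4) l1; first by rewrite divr_gt0// exprn_gt0.
pose y := T h - l *: h; pose u := h - T h.
have uE : u = (1 - l) *: h - y.
  by rewrite /u /y scalerBl scale1r opprB addrA subrK.
have Tu : T u - u = - ((1 - l) *: u) + (y - T y).
  have -> : T u = (1 - l) *: T h - T y by rewrite uE linearB linearZ.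
  rewrite {1}uE /u scalerBr !opprB [y - _ *: h]addrC addrACA.
  by rewrite [- T y + y]addrC.
have yle : rnorm y <= dl ^+ 2 / 4 := Th.
have ule : dl / 2 <= rnorm u.
  have := rnorm_sub_ge ((1 - l) *: h) y.
  by rewrite -uE rnormZ h1 l1d mulr1; nra.
have Tule : rnorm (T u - u) <= e * rnorm u.
  rewrite Tu; apply: (le_trans (rnormD _ _)); rewrite rnormN rnormZ l1d.
  have := rnormD y (- T y); rewrite rnormN; have := contrT y; nra.
have u0 : 0 < rnorm u by apply: lt_le_trans ule; rewrite divr_gt0.
pose c : R[i] := (rnorm u)^-1%:C.
have c1 : normc c = (rnorm u)^-1 by rewrite normcR ger0_norm// invr_ge0 ltW.
exists (c *: h); have -> : c *: h - T (c *: h) = c *: u by rewrite linearZ -scalerBr.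
split; first by rewrite rnormZ c1 mulVf// gt_eqF.
by rewrite linearZ -scalerBr rnormZ c1 mulrC ler_pdivrMr.
Qed.

End approximate_eigenvectors.

(** * Lp norms of bounded functions *)

Section norm_bounds.
Context d (S : measurableType d) (R : realType).
Variables (mu : {measure set S -> \bar R}) (p : R) (hp : 1 <= p).

Let p0 : 0 < p. Proof. exact: lt_le_trans hp. Qed.

Lemma measurable_normc_powR (f : S -> R[i]) : measurable_cfun f ->
  measurable_fun [set: S] (fun x => (normc (f x) `^ p)%:E).
Proof.
move=> mf; apply/measurable_EFinP; apply: (measurableT_comp (measurable_powR _)).
exact: measurable_normc.
Qed.

Lemma cLnorm_powR (f : S -> R[i]) :
  (cLnorm mu p f `^ p = \int[mu]_x (normc (f x) `^ p)%:E)%E.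
Proof.
rewrite cLnormE -poweRrM mulVf ?gt_eqF// poweRe1// integral_ge0// => x _.
by rewrite lee_fin powR_ge0.
Qed.

Lemma cLnorm_leP (f : S -> R[i]) (M : R) : 0 <= M ->
  (cLnorm mu p f <= M%:E)%E <->
  (\int[mu]_x (normc (f x) `^ p)%:E <= (M `^ p)%:E)%E.
Proof.
move=> M0; split => [fM|intM].
  rewrite -cLnorm_powR -poweR_EFin; apply: gt0_ler_poweR => //; first exact: ltW.
    by rewrite in_itv/= leey cLnorm_ge0.
  by rewrite in_itv/= leey andbT lee_fin.
have -> : (M%:E = (M `^ p)%:E `^ p^-1)%E.
  by rewrite poweR_EFin -powRrM mulfV ?gt_eqF// powRr1.
rewrite cLnormE; apply: gt0_ler_poweR => //.
- by rewrite invr_ge0 ltW.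
- by rewrite in_itv/= leey integral_ge0// => x _; rewrite lee_fin powR_ge0.
- by rewrite in_itv/= leey lee_fin powR_ge0.
Qed.

Lemma cLnorm_le_support (f : S -> R[i]) (B : set S) (M e : R) :
  measurable_cfun f -> measurable B -> 0 <= M -> 0 <= e ->
  (forall x, normc (f x) <= M) -> {ae mu, forall x, ~ B x -> f x = 0} ->
  (mu B <= (e `^ p)%:E)%E -> (cLnorm mu p f <= (M * e)%:E)%E.
Proof.
move=> mf mB M0 e0 fM fB Be; apply/cLnorm_leP; first exact: mulr_ge0.
apply: (@le_trans _ _ ((M `^ p)%:E * mu B)%E); last first.
  by rewrite powRM// EFinM lee_wpmul2l// lee_fin powR_ge0.
rewrite -[leRHS](_ : (\int[mu]_x ((M `^ p)%:E * (\1_B x)%:E) = _)%E); last first.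
  rewrite ge0_integralZl//; last by rewrite lee_fin powR_ge0.
    by rewrite integral_indic// setIT.
  by apply/measurable_EFinP; exact: measurable_indic.
apply: ae_ge0_le_integral => //.
- by move=> x _; rewrite lee_fin powR_ge0.
- exact: measurable_normc_powR.
- by move=> x _; rewrite -EFinM lee_fin mulr_ge0// powR_ge0.
- by apply: measurable_funeM; apply/measurable_EFinP; exact: measurable_indic.
apply: filterS fB => x fB _; rewrite -EFinM lee_fin.
have [xB|xB] := pselect (B x).
  rewrite indicE mem_set// mulr1 ge0_ler_powR ?nnegrE ?normc_ge0//.
  exact: ltW.
by rewrite fB// normc0 powR0 ?gt_eqF// mulr_ge0// powR_ge0.
Qed.

End norm_bounds.

(** * Sets of small positive measure *)

Section small_sets.
Context d (S : measurableType d) (R : realType).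

Lemma measurable_sublevel (A : set S) (f : S -> R) (c : R) : measurable A ->
  measurable_fun [set: S] f -> measurable (A `&` [set x | f x <= c]).
Proof.
move=> mA mf; apply: measurableI => //; rewrite -[X in measurable X]setTI.
by rewrite -preimage_itvNyc; exact: mf.
Qed.

Lemma measurable_superlevel (A : set S) (f : S -> R) (c : R) : measurable A ->
  measurable_fun [set: S] f -> measurable (A `&` [set x | c < f x]).
Proof.
move=> mA mf; apply: measurableI => //; rewrite -[X in measurable X]setTI.
by rewrite -preimage_itvoy; exact: mf.
Qed.

(** The constant is the supremum of the levels c such that f > c almost everywhere
    on A. *)
Lemma ae_constant_of_dichotomy (mu : {measure set S -> \bar R}) (A : set S)
    (f : S -> R) :
  measurable A -> measurable_fun [set: S] f -> (0 < mu A)%E ->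
  (forall c, mu (A `&` [set x | f x <= c]) = 0%E \/
             mu (A `&` [set x | c < f x]) = 0%E) ->
  exists s, mu.-negligible (A `&` [set x | f x <> s]).
Proof.
move=> mA mf A0 dich.
have mle c := measurable_sublevel c mA mf.
have mlt c := measurable_superlevel c mA mf.
have notnull (F : nat -> set S) : (forall n, mu.-negligible (F n)) ->
    A `<=` \bigcup_n F n -> False.
  move=> F0 AF; have /(negligibleP mu mA) A00 : mu.-negligible A.
    by apply: negligibleS AF _; exact: negligible_bigcup.
  by rewrite A00 ltxx in A0.
pose Z := [set c | mu (A `&` [set x | f x <= c]) = 0%E].
have Zdown c c' : c' <= c -> Z c -> Z c'.
  move=> cc' Zc; apply/(negligibleP mu (mle c')).
  move/(negligibleP mu (mle c)) : Zc; apply: negligibleS => x [Ax /= fx].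
  by split => //=; exact: le_trans cc'.
have Z0 : Z !=set0.
  apply: contrapT => /nonemptyPn Z0.
  apply: (notnull (fun n => A `&` [set x | - n%:R < f x])) => [n|x Ax].
    apply/negligibleP => //; have [Zn|//] := dich (- n%:R).
    by have : Z (- n%:R) by []; rewrite Z0.
  exists (Num.bound `|f x|) => //; split => //=.
  by have := archi_boundP (normr_ge0 (f x)); rewrite ltr_norml => /andP[].
have Zub : has_ubound Z.
  apply: contrapT => /has_ubPn Zub.
  apply: (notnull (fun n => A `&` [set x | f x <= n%:R])) => [n|x Ax].
    have [c Zc nc] := Zub n%:R.
    by apply/negligibleP => //; exact: Zdown (ltW nc) Zc.
  exists (Num.bound `|f x|) => //; split => //=.
  by have := archi_boundP (normr_ge0 (f x)); rewrite ltr_norml => /andP[_ /ltW].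
have supZ : has_sup Z by [].
exists (sup Z).
have sub : A `&` [set x | f x <> sup Z] `<=`
    \bigcup_n (A `&` [set x | f x <= sup Z - n.+1%:R^-1] `|`
                A `&` [set x | sup Z + n.+1%:R^-1 < f x]).
  move=> x [Ax /= fx].
  have : 0 < `|f x - sup Z| by rewrite normr_gt0 subr_eq0; apply/eqP.
  move=> /ltr_add_invr[n]; rewrite add0r => fn; exists n => //.
  have [fs|sf] := ltP (f x) (sup Z).
    left; split => //=; move: fn; rewrite ltr0_norm ?subr_lt0//.
    by set e := _^-1; lra.
  right; split => //=; move: fn; rewrite ger0_norm ?subr_ge0//.
  by set e := _^-1; lra.
apply: negligibleS sub _.
apply: negligible_bigcup => n; apply: negligibleU.
  apply/negligibleP => //.
  have n0 : 0 < n.+1%:R^-1 :> R by rewrite invr_gt0.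
  have [z Zz zs] := sup_adherent n0 supZ.
  exact: Zdown (ltW zs) Zz.
apply/negligibleP => //.
have [Zc|//] := dich (sup Z + n.+1%:R^-1).
have := ub_le_sup Zub Zc.
by rewrite gerDl leNgt invr_gt0 ltr0n.
Qed.

End small_sets.

Section partitions.
Context d (S : measurableType d) (R : realType).
Variables (mu : probability S R) (p : R) (hp : 1 <= p).

Lemma cLfun_bounded (f : S -> R[i]) (M : R) : measurable_cfun f ->
  (forall x, normc (f x) <= M) -> f \in cLfun mu hp.
Proof.
move=> mf fM; apply/asboolP; split => //.
have fM' x : normc (f x) <= `|M| by apply: le_trans (ler_norm _).
have mu1 : ((mu : {measure set S -> \bar R}) [set: S] <= (1 `^ p)%:E)%E.
  by rewrite powR1; exact: probability_le1.
apply: le_lt_trans (ltry (`|M| * 1)).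
apply: (cLnorm_le_support hp mf measurableT) mu1 => //.
by apply: aeW => x /(_ I).
Qed.

Lemma cLp_class_sum (I : Type) (s : seq I) (F : I -> cLfunType mu hp) :
  cLp_class (\sum_(i <- s) F i) = \sum_(i <- s) cLp_class (F i).
Proof.
apply: (big_morph (@cLp_class _ _ _ _ _ hp)); first exact: cLp_classD.
by rewrite /cLp_class raddf0.
Qed.

Lemma cLfun_sumE (I : Type) (s : seq I) (F : I -> cLfunType mu hp) x :
  (\sum_(i <- s) F i) x = \sum_(i <- s) F i x.
Proof. exact: (big_morph (fun f : cLfunType mu hp => f x)). Qed.

Lemma cLfun_scaleE (c : R[i]) (f : cLfunType mu hp) x : (c *: f) x = c * f x.
Proof. by []. Qed.

(** The partition into n sets of positive measure is encoded by the function that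
    gives the index of the cell of a point. *)
Definition measurable_partition (n : nat) (a : S -> nat) :=
  (forall x, (a x < n)%N) /\ forall k, (k < n)%N ->
    measurable (a @^-1` [set k]) /\ (0 < mu (a @^-1` [set k]))%E.

(** If no cell can be split, every real measurable function is almost everywhere
    constant on each cell, its superlevel sets being null or conull there; then the n
    indicators of the cells span the whole space. *)
Lemma refine_measurable_partition (n : nat) (a : S -> nat) :
  ~ finite_dimensional (cLp mu hp) -> measurable_partition n a ->
  exists b, measurable_partition n.+1 b.
Proof.
move=> infdim [an aP]; apply: contrapT => /forallNP noref; apply: infdim.
pose A k := a @^-1` [set k].
have ae_cst f : measurable_fun [set: S] f ->
    exists s : nat -> R, {ae mu, forall x, f x = s (a x)}.
  move=> mf.
  have /choice[s sP] k : exists s, (k < n)%N -> mu.-negligible (A k `&` [set x | f x <> s]).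
    have [kn|kn] := ltnP k n; last by exists 0.
    have [mA A0] := aP _ kn.
    have [|s sP] := @ae_constant_of_dichotomy _ _ _ mu _ f mA mf A0; last by exists s.
    move=> c; apply: contrapT => /not_orP[le0 gt0].
    have mle := measurable_sublevel c mA mf.
    have mgt := measurable_superlevel c mA mf.
    (* a threshold with both sides of positive measure splits the cell k in two *)
    pose b x := if (a x == k) && (c < f x) then n else a x.
    apply: (noref b); split=> [x|j jn].
      by rewrite /b; case: ifP => // _; rewrite ltnS ltnW.
    have [->|jNn] := eqVneq j n.
      have -> : b @^-1` [set n] = A k `&` [set x | c < f x].
        apply/seteqP; split => x /=; rewrite /b.
          case: ifP => [/andP[/eqP]//|_ xn].
          by have := an x; rewrite xn ltnn.
        by move=> [/eqP -> ->].
      by split => //; rewrite lt0e measure_ge0 andbT; apply/eqP.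
    have {}jn : (j < n)%N by rewrite ltn_neqAle jNn -ltnS.
    have [->|jk] := eqVneq j k.
      have -> : b @^-1` [set k] = A k `&` [set x | f x <= c].
        apply/seteqP; split => x /=; rewrite /b.
          case: ifP => [_ nk|/negbT]; first by rewrite nk ltnn in kn.
          by rewrite negb_and -leNgt => /orP[/eqP//|].
        by move=> [-> ]; rewrite leNgt => /negbTE ->; rewrite andbF.
      by split => //; rewrite lt0e measure_ge0 andbT; apply/eqP.
    have -> : b @^-1` [set j] = A j; last exact: aP.
    apply/seteqP; split => x /=; rewrite /b.
      by case: ifP => // _ nj; rewrite nj ltnn in jn.
    by move=> ->; rewrite (negbTE jk).
  exists s.
  have sub : ~` [set x | f x = s (a x)] `<=`
      \bigcup_k (if (k < n)%N then A k `&` [set x | f x <> s k] else set0).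
    by move=> x /= fx; exists (a x) => //; rewrite an.
  apply: negligibleS sub _; apply: negligible_bigcup => k.
  by case: ifP => [|_]; [exact: sP|exact: negligible_set0].
have ind_in (k : 'I_n) : (fun x => (a x == k)%:R) \in cLfun mu hp.
  have [mA _] := aP _ (ltn_ord k).
  apply: (@cLfun_bounded _ 1); last first.
    by move=> x; case: eqP => _; rewrite ?normc1 ?normc0.
  split.
    rewrite (_ : (fun _ => _) = \1_(A k)).
      exact: measurable_indic.
    apply/funext => x; rewrite indicE /=; case: eqP => xk.
      by rewrite mem_set.
    by rewrite memNset.
  rewrite (_ : (fun _ => _) = cst 0); first exact: measurable_cst.
  by apply/funext => x /=; case: eqP.
exists n, (fun k => cLp_class (CLfun (ind_in k))); elim/cLp_ind => f.
have [mr mi] := cLfun_measurable f.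
have [s sP] := ae_cst _ mr; have [t tP] := ae_cst _ mi.
exists (fun k => Complex (s k) (t k)).
under eq_bigr do rewrite -cLp_classZ.
rewrite -cLp_class_sum; apply/cLp_classP.
apply: filterS2 sP tP => x sx tx _.
rewrite cLfun_sumE (bigD1 (Ordinal (an x)))// big1.
  by rewrite cLfun_scaleE /= eqxx mulr1 addr0 -sx -tx; case: (f x).
move=> k kx; rewrite cLfun_scaleE /=.
by case: eqP => [axk|_]; rewrite ?mulr0//; rewrite -val_eqE /= axk eqxx in kx.
Qed.

(** A partition into more than 1/e cells of positive measure has a cell of measure
    at most e. *)
Lemma small_measurable_sets : ~ finite_dimensional (cLp mu hp) ->
  forall e : R, 0 < e -> exists B, [/\ measurable B, (0 < mu B)%E & (mu B <= e%:E)%E].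
Proof.
move=> infdim e e0.
have part n : exists a, measurable_partition n.+1 a.
  elim: n => [|n [a aP]]; last exact: refine_measurable_partition aP.
  exists (fun=> 0%N); split => // k; rewrite ltnS leqn0 => /eqP ->.
  rewrite preimage_cst mem_set// probability_setT; split => //.
pose n := Num.bound e^-1.
have [a [an aP]] := part n.
apply: contrapT => /forallNP nosmall.
have big k : (k < n.+1)%N -> (e%:E <= mu (a @^-1` [set k]))%E.
  move=> /aP[mA A0]; rewrite leNgt; apply/negP => /ltW Ae.
  by apply: (nosmall (a @^-1` [set k])); split.
have : (mu (\big[setU/set0]_(k < n.+1) (a @^-1` [set nat_of_ord k])) <= 1)%E.
  apply: probability_le1; apply: bigsetU_measurable => k _.
  by have [] := aP k (ltn_ord k).
rewrite measure_bigsetU_ord//=; last 2 first.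
- by move=> k; have [] := aP k (ltn_ord k).
- apply/trivIsetP => i j _ _ ij; rewrite -subset0 => x [/= -> /val_inj /eqP].
  by rewrite (negbTE ij).
apply/negP; rewrite -ltNge.
have : (1 < \sum_(k < n.+1) e%:E)%E.
  rewrite sumEFin lte_fin sumr_const card_ord -mulr_natr -ltr_pdivrMl// mulr1.
  apply: (lt_le_trans (archi_boundP _)); first by rewrite invr_ge0 ltW.
  by rewrite ler_nat.
move=> /lt_le_trans; apply; apply: lee_sum => k _; exact: big.
Qed.

End partitions.

(** * First hitting times *)

Section first_hit.
Context d (S : measurableType d) (R : realType).
Variables (mu : probability S R) (theta : S -> S).
Hypothesis mptheta : measure_preserving mu theta.
Implicit Types (A B : set S) (x : S) (k : nat).

Definition hits B k := iter k theta @^-1` B.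

Lemma hitsS B k : hits B k.+1 = theta @^-1` hits B k.
Proof. by apply/funext => x; rewrite /hits /preimage/= -iterS iterSr. Qed.

(** The default 0 is taken where the orbit avoids [B], on a null set if theta is
    ergodic and [B] has positive measure. *)
Definition first_hit B x : nat :=
  xget 0%N [set k | hits B k x /\ forall j, (j < k)%N -> ~ hits B j x].

Lemma first_hit_unique B x k : hits B k x ->
  (forall j, (j < k)%N -> ~ hits B j x) -> first_hit B x = k.
Proof.
move=> xk kmin; have [|xj jmin] := @xgetPex _ 0%N
    [set k | hits B k x /\ forall j, (j < k)%N -> ~ hits B j x].
  by exists k.
rewrite -/(first_hit B x) in xj jmin; move: (first_hit B x) xj jmin => j xj jmin.
by case: (ssrnat.ltngtP j k) => // [jk|kj]; [case: (kmin _ jk)|case: (jmin _ kj)].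
Qed.

Lemma first_hit_none B x : ~ (exists k, hits B k x) -> first_hit B x = 0%N.
Proof.
by move=> nohit; rewrite /first_hit xgetPN// => k [xk _]; apply: nohit; exists k.
Qed.

Lemma first_hit_min B x : (exists k, hits B k x) ->
  hits B (first_hit B x) x /\ forall j, (j < first_hit B x)%N -> ~ hits B j x.
Proof.
move=> [k xk]; have ex : exists k, `[< hits B k x >] by exists k; exact/asboolP.
have [m /asboolP xm mmin] := ex_minnP ex.
have mmin' j : (j < m)%N -> ~ hits B j x.
  by move=> jm xj; have := mmin j (asboolT xj); rewrite leqNgt jm.
by rewrite (first_hit_unique xm mmin').
Qed.

Lemma first_hitS B x : ~ B x -> (exists k, hits B k x) ->
  first_hit B x = (first_hit B (theta x)).+1.
Proof.
move=> nBx xB; have [] := first_hit_min xB.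
case: (first_hit B x) => [//|n]; rewrite hitsS => xn nmin.
congr _.+1; apply/esym/first_hit_unique => // j jn.
by have := nmin j.+1 jn; rewrite hitsS.
Qed.

Lemma measurable_hits B k : measurable B -> measurable (hits B k).
Proof.
move=> mB; elim: k => [//|k IH].
rewrite hitsS -[X in measurable X]setTI; exact: mptheta.1.
Qed.

Lemma measure_hits B k : measurable B -> mu (hits B k) = mu B.
Proof.
move=> mB; elim: k => [//|k IH].
by rewrite hitsS mptheta.2//; exact: measurable_hits.
Qed.

Lemma measurable_fun_first_hit B (phi : nat -> R) : measurable B ->
  measurable_fun [set: S] (fun x => phi (first_hit B x)).
Proof.
move=> mB _ Y mY; rewrite setTI.
have -> : (fun x => phi (first_hit B x)) @^-1` Y =
    \bigcup_(k in phi @^-1` Y) (first_hit B @^-1` [set k]).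
  by apply/seteqP; split=> [x Yx|x [k Yk /= xk]]; [exists (first_hit B x)|rewrite /= xk].
apply: bigcup_measurable => k _.
pose E k := hits B k `\` \bigcup_(j in `I_k) hits B j.
have mE j : measurable (E j).
  apply: measurableD; first exact: measurable_hits.
  by apply: bigcup_measurable => i _; exact: measurable_hits.
have EP j x : E j x -> first_hit B x = j.
  move=> [xj xnot]; apply: first_hit_unique => // i ij xi; apply: xnot.
  by exists i.
have PE x : (exists k, hits B k x) -> E (first_hit B x) x.
  by move=> /first_hit_min[xk kmin]; split => // -[j jk xj]; exact: kmin jk xj.
pose C := \bigcup_k hits B k.
have mC : measurable C by apply: bigcupT_measurable => j; exact: measurable_hits.
have -> : first_hit B @^-1` [set k] = E k `|` (if k == 0%N then ~` C else set0).
  apply/seteqP; split=> [x /= xk|x [/EP//|]].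
    have [xC|xC] := pselect (exists k, hits B k x).
      by left; have := PE x xC; rewrite xk.
    right; suff -> : k = 0%N by move=> [j _ xj]; apply: xC; exists j.
    by rewrite -[LHS]xk first_hit_none.
  case: ifP => // /eqP -> xC; apply: first_hit_none => -[j xj].
  by apply: xC; exists j.
apply: measurableU => //; case: ifP => // _; exact: measurableC.
Qed.

(** The set C of the points that hit B satisfies theta^-1 C <= C. Its preimages
    decrease to a strictly invariant set D, which has the measure of C because theta
    preserves measure. Ergodicity makes D null or conull, and D cannot be null since
    C contains B. *)
Lemma ergodic_ae_hits B : ergodic mu theta -> measurable B -> (0 < mu B)%E ->
  {ae mu, forall x, exists k, hits B k x}.
Proof.
move=> erg mB B0; pose C := \bigcup_k hits B k.
have mC : measurable C by apply: bigcupT_measurable => j; exact: measurable_hits.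
pose D := \bigcap_j hits C j.
have mD : measurable D by apply: bigcapT_measurable => j; exact: measurable_hits.
have decr j : hits C j.+1 `<=` hits C j.
  by move=> x [k _ xk]; exists k.+1 => //; rewrite hitsS; exact: xk.
have thD : theta @^-1` D = D.
  apply/seteqP; split=> x xD j _.
    by apply: decr; rewrite hitsS; exact: xD.
  by have := xD j.+1 I; rewrite hitsS.
have muD : mu D = mu C.
  have cvgD : mu (hits C j) @[j --> \oo] --> mu D.
    apply: nonincreasing_cvg_mu => //.
    - by rewrite (le_lt_trans (probability_le1 _ _))// ltry.
    - by move=> j; exact: measurable_hits.
    - by apply/nonincreasing_seqP => j; apply/subsetPset; exact: decr.
  have cvgC : mu (hits C j) @[j --> \oo] --> mu C.
    by under eq_fun do rewrite measure_hits//; exact: cvg_cst.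
  by apply: (cvg_unique _ cvgD cvgC).
have B_C : B `<=` C by move=> x xB; exists 0%N.
have [D0|D1] := erg D mD thD.
  have : (mu B <= mu C)%E by apply: le_measure; rewrite ?inE.
  by rewrite -muD D0 leNgt B0.
exists (~` D); split => //; first exact: measurableC.
by move=> x /= xC xD; apply: xC; have [k _ xk] := xD 0%N I; exists k.
Qed.

End first_hit.

(** * Approximate eigenvectors of the Koopman operator *)

Section koopman_eigenvectors.
Context d (S : measurableType d) (R : realType).
Variables (mu : probability S R) (theta : S -> S).
Hypotheses (mptheta : measure_preserving mu theta) (erg : ergodic mu theta).
Variables (p : R) (hp : 1 <= p).
Local Notation T := (koopman mptheta hp).

Lemma rnorm_class (f : cLfunType mu hp) :
  rnorm (cLp_class f) = fine (cLnorm mu p f).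
Proof. by apply: (@complexI R); rewrite -rnormE; exact: cLp_norm_class. Qed.

(** For r the first hitting time of a set B, the function h = l^-r satisfies
    h o theta = l h off B, because r drops by one along the orbit until B is reached.
    On B the error is at most 2, hence small in norm if B has small measure, while h
    has modulus 1 everywhere. *)
Lemma koopman_approximate_eigenvector :
  ~ finite_dimensional (cLp mu hp) -> forall (l : R[i]) (e : R),
  normc l = 1 -> 0 < e -> exists h, rnorm h = 1 /\ rnorm (T h - l *: h) <= e.
Proof.
move=> infdim l e l1 e0; have p0 : 0 < p := lt_le_trans ltr01 hp.
have l0 : l != 0 by apply: contra_eq_neq l1 => ->; rewrite normc0 eq_sym oner_eq0.
have [B [mB B0 Be]] := small_measurable_sets infdim
  (powR_gt0 p (divr_gt0 e0 (ltr0Sn R 1))).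
pose h x := l^-1 ^+ first_hit theta B x.
have h1 x : normc (h x) = 1.
  rewrite /h; elim: (first_hit _ _ _) => [|n IH]; first by rewrite expr0 normc1.
  by rewrite exprS normcM IH normcV l1 invr1 mulr1.
have mh : measurable_cfun h.
  split; first exact: (measurable_fun_first_hit mptheta
    (fun n => complex.Re (l^-1 ^+ n))).
  exact: (measurable_fun_first_hit mptheta (fun n => complex.Im (l^-1 ^+ n))).
have h_in : h \in cLfun mu hp.
  by apply: (@cLfun_bounded _ _ _ _ _ _ _ 1) => // x; rewrite h1.
pose f : cLfunType mu hp := CLfun h_in.
exists (cLp_class f); split.
  rewrite rnorm_class cLnormE.
  have -> : (\int[mu]_x (normc (f x) `^ p)%:E = 1)%E.
    under eq_integral do rewrite /= h1 powR1.
    rewrite integral_cst// mul1e; exact: probability_setT.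
  by rewrite poweR1r.
pose g : cLfunType mu hp := CLfun (cLfun_comp_mp mptheta f) + (- l) *: f.
have -> : T (cLp_class f) - l *: cLp_class f = cLp_class g.
  by rewrite koopman_class /g cLp_classD cLp_classZ scaleNr.
have gE x : g x = h (theta x) - l * h x by rewrite -mulNr.
rewrite rnorm_class -lee_fin fineK ?cLfun_fin_num//.
have g2 x : normc (g x) <= 2.
  rewrite gE; apply: le_trans (normcD_le _ _) _.
  by rewrite -mulNr normcM normcN l1 mul1r !h1.
have gB : {ae mu, forall x, ~ B x -> g x = 0}.
  apply: filterS (ergodic_ae_hits mptheta erg mB B0) => x xB nBx.
  rewrite gE /h (first_hitS nBx xB) exprS mulrA divff// mul1r subrr//.
have -> : e = 2 * (e / 2) by field.
apply: (cLnorm_le_support hp (cLfun_measurable g) mB) Be => //.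
by rewrite divr_ge0// ltW.
Qed.

Lemma rnorm_koopman u : rnorm (T u) = rnorm u.
Proof. by rewrite /rnorm norm_koopman. Qed.

End koopman_eigenvectors.

(** * Convergence of geometrically dominated series in Lp *)

Section completeness.
Context d (S : measurableType d) (R : realType).

Lemma powR_cvg (u : R^nat) (l p : R) : 0 < p -> (forall n, 0 <= u n) ->
  u @ \oo --> l -> u n `^ p @[n --> \oo] --> l `^ p.
Proof.
move=> p0 u0 ul.
have : 0 <= l by apply: (cvgr_to_ge ul); exact: nearW.
rewrite le_eqVlt => /predU1P[l0|l0].
  rewrite -l0 powR0 ?gt_eqF//; apply/cvgrPdist_le => e e0.
  move: ul; rewrite -l0 => /cvgrPdist_le/(_ _ (powR_gt0 p^-1 e0)).
  apply: filterS => n; rewrite !sub0r !normrN !ger0_norm ?powR_ge0// => une.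
  have -> : e = (e `^ p^-1) `^ p by rewrite -powRrM mulVf ?gt_eqF// powRr1 ?ltW.
  by apply: ge0_ler_powR; rewrite ?nnegrE ?powR_ge0//; exact: ltW.
have powRE (x : R) : 0 < x -> x `^ p = expR (p * ln x).
  by move=> x0; rewrite /powR gt_eqF.
rewrite powRE//; have upow : \forall n \near \oo, expR (p * ln (u n)) = u n `^ p.
  move/cvgrPdist_lt : ul => /(_ _ l0); apply: filterS => n.
  by rewrite ltr_norml => /andP[_ un]; rewrite powRE//; lra.
apply: cvg_trans (near_eq_cvg upow) _.
apply: continuous_cvg; first exact: continuous_expR.
by apply: cvgM; [exact: cvg_cst|apply: continuous_cvg => //; exact: continuous_ln].
Qed.

Lemma limn_einf_le (u : (\bar R)^nat) (M : \bar R) :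
  (forall n, u n <= M)%E -> (limn_einf u <= M)%E.
Proof.
move=> uM; rewrite limn_einf_lim; apply: lime_le; first exact: is_cvg_einfs.
apply: nearW => n; apply: le_trans (uM n); apply: ereal_inf_lbound.
by exists n => /=.
Qed.

Variables (mu : {measure set S -> \bar R}) (p : R) (hp : 1 <= p).

(** Fatou's lemma for the p-th powers of the moduli. *)
Lemma cLnorm_fatou (f : nat -> S -> R[i]) (g : S -> R[i]) (M : R) :
  0 <= M -> (forall n, measurable_cfun (f n)) -> measurable_cfun g ->
  (forall n, cLnorm mu p (f n) <= M%:E)%E ->
  {ae mu, forall x, complex.Re (f n x) @[n --> \oo] --> complex.Re (g x)} ->
  {ae mu, forall x, complex.Im (f n x) @[n --> \oo] --> complex.Im (g x)} ->
  (cLnorm mu p g <= M%:E)%E.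
Proof.
move=> M0 mf mg fM cvRe cvIm; have p0 : 0 < p := lt_le_trans ltr01 hp.
apply/cLnorm_leP => //.
rewrite (@ge0_ae_eq_integral _ _ _ mu setT _
  (fun x => limn_einf (fun n => (normc (f n x) `^ p)%:E)))//; first last.
- apply: filterS2 cvRe cvIm => x fRe fIm _; apply/esym.
  apply: (cvg_limn_einf_sup _).1; apply: cvg_EFin; first exact: nearW.
  apply: powR_cvg => // [n|]; first exact: normc_ge0.
  have normcE (z : R[i]) :
      normc z = Num.sqrt (complex.Re z * complex.Re z + complex.Im z * complex.Im z).
    by case: z.
  rewrite normcE; under eq_fun do rewrite normcE.
  apply: continuous_cvg; first exact: sqrt_continuous.
  by apply: cvgD; exact: cvgM.
- move=> x _; rewrite limn_einf_lim; apply: lime_ge; first exact: is_cvg_einfs.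
  apply: nearW => n; apply: le_ereal_inf_tmp => _ [k _ <-].
  by rewrite lee_fin powR_ge0.
- by move=> x _; rewrite lee_fin powR_ge0.
- rewrite /limn_einf; apply: measurableT_comp => //.
  apply: measurable_fun_limn_esup => n; apply: measurableT_comp => //.
  exact: measurable_normc_powR.
- exact: measurable_normc_powR.
apply: le_trans (fatou mu measurableT _ _) _.
- by move=> n; exact: measurable_normc_powR.
- by move=> n x _; rewrite lee_fin powR_ge0.
apply: limn_einf_le => n; exact/cLnorm_leP.
Qed.

End completeness.

Section riesz_fischer.
Context d (S : measurableType d) (R : realType).
Variables (mu : probability S R) (p : R) (hp : 1 <= p).

(** Integrate t <= c + c (t / c)^p, which holds because s <= 1 + s^p for s >= 0. *)
Lemma integral_normc_le (f : S -> R[i]) (c : R) : measurable_cfun f -> 0 < c ->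
  (cLnorm mu p f <= c%:E)%E -> (\int[mu]_x (normc (f x))%:E <= (c + c)%:E)%E.
Proof.
move=> mf c0 fc; have p0 : 0 < p := lt_le_trans ltr01 hp.
have c0' := ltW c0; have ci0 : 0 <= c^-1 by rewrite invr_ge0.
have mn := measurable_normc mf.
have mnp := measurable_normc_powR p mf.
have k0 : 0 <= c * c^-1 `^ p by rewrite mulr_ge0 ?powR_ge0.
have le x : ((normc (f x))%:E <= c%:E + (c * c^-1 `^ p)%:E * (normc (f x) `^ p)%:E)%E.
  rewrite -EFinM -EFinD lee_fin -mulrA -powRM ?normc_ge0//.
  have -> : forall y, c + c * y = c * (1 + y) by move=> y; ring.
  rewrite -ler_pdivrMl//; set t := c^-1 * _; have t0 : 0 <= t by rewrite mulr_ge0 ?normc_ge0.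
  have [t1|t1] := leP t 1; first by rewrite (le_trans t1)// lerDl powR_ge0.
  by rewrite (@le_trans _ _ (t `^ p)) ?lerDr// -{1}[t]powRr1// ler_powR// ltW.
apply: le_trans (ge0_le_integral mu measurableT _ _ _ (fun x _ => le x)) _.
- by move=> x _; rewrite lee_fin normc_ge0.
- exact/measurable_EFinP.
- by apply: emeasurable_funD => //; exact: measurable_funeM.
have mu1 : mu [set: S] = 1%E by exact: probability_setT.
rewrite ge0_integralD//; last 2 first.
- by move=> x _; rewrite mule_ge0// lee_fin// powR_ge0.
- exact: measurable_funeM.
rewrite integral_cst// ge0_integralZl//; last first.
  by move=> x _; rewrite lee_fin powR_ge0.
rewrite [X in (_ * X + _)%E]mu1 mule1 EFinD leeD2l//.
apply: (@le_trans _ _ ((c * c^-1 `^ p)%:E * (c `^ p)%:E)%E).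
  by apply: lee_wpmul2l; [rewrite lee_fin|apply/cLnorm_leP].
rewrite -EFinM lee_fin -mulrA -powRM// mulVf ?gt_eqF//.
by rewrite powR1 mulr1.
Qed.

Lemma cvg_series_of_nneseries (u : R^nat) : (forall n, 0 <= u n) ->
  (\sum_(0 <= n <oo) (u n)%:E < +oo)%E -> cvgn (series u).
Proof.
move=> u0 ufin; apply: nondecreasing_is_cvgn.
  by apply: nondecreasing_series => n _ _; exact: u0.
exists (fine (\sum_(0 <= n <oo) (u n)%:E)%E) => _ [n _ <-].
have s0 : (0 <= \sum_(0 <= n <oo) (u n)%:E)%E.
  by apply: nneseries_ge0 => k _ _; rewrite lee_fin.
rewrite -lee_fin fineK ?ge0_fin_numE// /series/= -sumEFin.
by apply: nneseries_lim_ge => k _ _; rewrite lee_fin.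
Qed.

(** The sum of the moduli has finite integral. *)
Lemma ae_summable_of_geometric_norms (f : nat -> S -> R[i]) :
  (forall n, measurable_cfun (f n)) ->
  (forall n, (cLnorm mu p (f n) <= (4^-1 ^+ n)%:E)%E) ->
  {ae mu, forall x, cvgn (series (fun n => normc (f n x)))}.
Proof.
move=> mf fle; pose F x := (\sum_(0 <= n <oo) (normc (f n x))%:E)%E.
have mn n : measurable_fun [set: S] (fun x => (normc (f n x))%:E).
  by apply/measurable_EFinP; exact: measurable_normc.
have F0 x : (0 <= F x)%E.
  by apply: nneseries_ge0 => k _ _; rewrite lee_fin normc_ge0.
have Fint : mu.-integrable [set: S] F.
  apply/integrableP; split.
    by apply: ge0_emeasurable_sum => // n x _ _; rewrite lee_fin normc_ge0.
  under eq_integral do rewrite gee0_abs//.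
  rewrite /F integral_nneseries//; last by move=> n x _; rewrite lee_fin normc_ge0.
  apply: (@le_lt_trans _ _ 3%:E); last exact: ltry.
  apply: lime_le.
    apply: is_cvg_nneseries => n _ _; apply: integral_ge0 => x _.
    by rewrite lee_fin normc_ge0.
  apply: nearW => n; apply: (@le_trans _ _ (3 * (1 - 4^-1 ^+ n))%:E); last first.
    by rewrite lee_fin ler_piMr// gerBl exprn_ge0.
  elim: n => [|n IH]; first by rewrite big_geq// subrr mulr0.
  rewrite big_nat_recr//=; apply: (le_trans (leeD IH (integral_normc_le (mf n) _ (fle n)))).
    by rewrite exprn_gt0.
  have : 0 <= 4^-1 ^+ n :> R by [].
  by rewrite -EFinD lee_fin exprS; set a := _ ^+ n; lra.
have := integrable_ae measurableT Fint; apply: filterS => x /(_ I) Fx.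
apply: cvg_series_of_nneseries => [n|]; first exact: normc_ge0.
by rewrite -ge0_fin_numE//; exact: F0.
Qed.

(** The case of the Riesz-Fischer theorem that the gliding hump needs. The partial
    sums converge almost everywhere, and Fatou's lemma bounds the distance from the
    pointwise limit to a partial sum by the norms of the later blocks. *)
Lemma cLp_geometric_series_cvg (y : (cLp mu hp)^nat) :
  (forall n, rnorm (y n) <= 4^-1 ^+ n) -> cvgn (series y).
Proof.
move=> yle; pose f n : cLfunType mu hp := repr (y n).
have fy n : cLp_class (f n) = y n by rewrite /cLp_class reprK.
have mf n : measurable_cfun (f n) by exact: cLfun_measurable.
have fle n : (cLnorm mu p (f n) <= (4^-1 ^+ n)%:E)%E.
  by have := yle n; rewrite -fy rnorm_class -lee_fin fineK// cLfun_fin_num.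
pose s n : cLfunType mu hp := \sum_(0 <= k < n) f k.
have sy n : cLp_class (s n) = series y n.
  by rewrite cLp_class_sum; apply: eq_bigr => k _; exact: fy.
have ms n : measurable_cfun (s n) by exact: cLfun_measurable.
(* an upper limit is measurable even where the partial sums diverge *)
pose gRe x := fine (limn_esup (fun n => (complex.Re (s n x))%:E)).
pose gIm x := fine (limn_esup (fun n => (complex.Im (s n x))%:E)).
pose g x := Complex (gRe x) (gIm x).
have mg : measurable_cfun g.
  split; [change (measurable_fun [set: S] gRe)|change (measurable_fun [set: S] gIm)];
    apply: (measurableT_comp (f := @fine R)) => //;
    apply: measurable_fun_limn_esup => n;
    by apply/measurable_EFinP; case: (ms n).
have ae_cvg (proj : R[i] -> R) : {morph proj : a b / a + b} -> proj 0 = 0 ->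
    (forall z, `|proj z| <= normc z) ->
    {ae mu, forall x, proj (s n x) @[n --> \oo] -->
      fine (limn_esup (fun n => (proj (s n x))%:E))}.
  move=> projD proj0 projle; have := ae_summable_of_geometric_norms mf fle.
  apply: filterS => x sumx.
  have sE n : proj (s n x) = series (fun k => proj (f k x)) n.
    by rewrite cLfun_sumE (big_morph proj projD proj0).
  have cvs : cvgn (fun n => proj (s n x)).
    under eq_fun do rewrite sE.
    apply: normed_cvg; apply: series_le_cvg sumx => n //=.
    exact: normc_ge0.
  have -> : limn_esup (fun n => (proj (s n x))%:E) = (limn (fun n => proj (s n x)))%:E.
    by apply: (cvg_limn_einf_sup _).2; apply: cvg_EFin; [exact: nearW|exact: cvs].
  exact: cvs.
have projle (a b : R) : `|a| <= Num.sqrt (a ^+ 2 + b ^+ 2).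
  by rewrite -sqrtr_sqr ler_wsqrtr// lerDl sqr_ge0.
have sRe : {ae mu, forall x, complex.Re (s n x) @[n --> \oo] --> gRe x}.
  by apply: ae_cvg => [[a b] [a' b']|//|[a b]] //=.
have sIm : {ae mu, forall x, complex.Im (s n x) @[n --> \oo] --> gIm x}.
  by apply: ae_cvg => [[a b] [a' b']|//|[a b]] //=; rewrite addrC.
have classB (h k : cLfunType mu hp) : cLp_class (h - k) = cLp_class h - cLp_class k.
  by rewrite /cLp_class raddfB.
have gs n : (cLnorm mu p (fun x => (g x - s n x)%R) <= (2 * 4^-1 ^+ n)%:E)%E.
  have ReB (a b : R[i]) : complex.Re (a - b) = complex.Re a - complex.Re b.
    by case: a b => ? ? [? ?].
  have ImB (a b : R[i]) : complex.Im (a - b) = complex.Im a - complex.Im b.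
    by case: a b => ? ? [? ?].
  have shift (u : R^nat) l k c : u @ \oo --> l -> u (m + k)%N - c @[m --> \oo] --> l - c.
    by move=> ul; apply: cvgB; [rewrite (cvg_shiftn k u)|exact: cvg_cst].
  apply: (@cLnorm_fatou _ _ _ mu p hp
    (fun m => (s (m + n)%N - s n : cLfunType mu hp) : S -> R[i])).
  - by rewrite mulr_ge0.
  - by move=> m; exact: cLfun_measurable.
  - have -> : (fun x => g x - s n x) = g + (-1) *: (s n : S -> R[i]).
      by rewrite scaleN1r.
    by apply: measurable_cfunD => //; exact: measurable_cfunZ.
  - move=> m; rewrite -[leLHS]fineK ?cLfun_fin_num// -rnorm_class classB !sy addnC lee_fin.
    apply: le_trans (rnorm_geometric_tail yle _ _) _.
    rewrite mulrC ler_wpM2r//; have : 0 <= 4^-1 ^+ m :> R by [].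
    by lra.
  - apply: filterS sRe => x /(shift _ _ n (complex.Re (s n x))).
    by under eq_fun do rewrite -ReB; rewrite -[gRe x]/(complex.Re (g x)) -ReB.
  - apply: filterS sIm => x /(shift _ _ n (complex.Im (s n x))).
    by under eq_fun do rewrite -ImB; rewrite -[gIm x]/(complex.Im (g x)) -ImB.
have g_in : g \in cLfun mu hp.
  have gE : (fun x => g x - s 0%N x) = g.
    apply/funext => x; have -> : s 0%N x = 0 by rewrite /s big_geq.
    by rewrite subr0.
  apply/asboolP; split => //; have := gs 0%N; rewrite gE => g2.
  exact: le_lt_trans g2 (ltry _).
apply/cvg_ex; exists (cLp_class (CLfun g_in)); apply/rnorm_cvgP => e e0.
have cv : 2 * 4^-1 ^+ n @[n --> \oo] --> (2 * 0 : R).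
  apply: cvgM; first exact: cvg_cst.
  by apply: cvg_expr; rewrite ger0_norm// invf_lt1// ltr1n.
move/cvgrPdist_le : cv => /(_ _ e0); apply: filterS => n.
rewrite mulr0 sub0r normrN ger0_norm ?mulr_ge0// => le.
apply: le_trans le; rewrite -sy -classB rnorm_class -lee_fin fineK ?cLfun_fin_num//.
exact: gs.
Qed.

End riesz_fischer.

(** * Failure of uniform ergodicity and a divergent Hilbert series *)

Theorem corollary5p3 (d : measure_display) (S : measurableType d)
    (R : realType) (mu : probability S R) (theta : S -> S)
    (mptheta : measure_preserving mu theta) (ergtheta : ergodic mu theta)
    (p : R) (hp : 1 <= p) (infdim : ~ finite_dimensional (cLp mu hp)) :
  let T : {linear cLp mu hp -> cLp mu hp} := koopman mptheta hp in
  ~ uniformly_ergodic T /\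
  exists f : cLp mu hp,
    closure (range (fun g : cLp mu hp => g - T g)) f /\
    ~ cvgn (fun N : nat => \sum_(1 <= n < N.+1) n%:R^-1 *: iter n T f).
Proof.
move=> T; have contrT u : rnorm (T u) <= rnorm u by rewrite rnorm_koopman.
have ai : almost_invariant_coboundaries T.
  apply: almost_invariant_of_approximate_eigenvectors => // l e.
  exact: koopman_approximate_eigenvector.
split; first exact: not_uniformly_ergodic.
by apply: divergent_hilbert_series => // y; exact: cLp_geometric_series_cvg.
Qed.
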